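(* Let $\mathcal{H}$ be a real Hilbert space, $A:\mathcal{H}\rightrightarrows\mathcal{H}$ a maximally monotone operator, and $B:\mathcal{H}\to\mathcal{H}$ a monotone and $\frac1\beta$-Lipschitz continuous operator with $\beta>0$. Let $A+B$ be $\rho$-strongly monotone for some $\rho>0$, and let $\gamma:[0,+\infty)\to(0,\beta)$ be Lebesgue measurable and such that for some $\delta,\varepsilon>0$ we have $\delta\le\gamma(t)\le\beta-\varepsilon$ for all $t\in[0,+\infty)$. Let $x_0\in\mathcal{H}$ and let $x,z:[0,+\infty)\to\mathcal{H}$ be the trajectories generated by $$z(t)=J_{\gamma(t)A}\big(x(t)-\gamma(t)Bx(t)\big),\qquad 0=\dot x(t)+x(t)-z(t)-\gamma(t)Bx(t)+\gamma(t)Bz(t),\qquad x(0)=x_0.$$ Then the trajectory $x(t)$ converges to the unique element $\bar x$ of $\mathrm{Zer}(A+B)$ with an exponential rate as $t\to+\infty$, i.e. there exist constants $C\ge 0$ and $c>0$ such that $\|x(t)-\bar x\|\le Ce^{-ct}$ for all $t\in[0,+\infty)$.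
   Context: $J_{\gamma A}=(\mathrm{Id}+\gamma A)^{-1}$ is the resolvent of $\gamma A$ (single-valued and everywhere defined for $\gamma>0$). $\mathrm{Zer}(M)=\{x\in\mathcal{H}: 0\in Mx\}$. A set-valued operator $M:\mathcal{H}\rightrightarrows\mathcal{H}$ is $\rho$-strongly monotone if $\langle x-y,x^*-y^*\rangle\ge\rho\|x-y\|^2$ for all $x,y\in\mathcal{H}$, $x^*\in Mx$, $y^*\in My$. ($A+B$ is maximally monotone and strongly monotone, so $\mathrm{Zer}(A+B)$ is a singleton.) The differential system is understood in the strong global sense: $x$ is locally absolutely continuous on $[0,+\infty)$ (i.e. on each $[0,b]$, $0<b<+\infty$, it is the integral of an integrable function $\dot x$ plus the constant $x(0)$), $z(t)$ is defined by the first equation for all $t$, the second equation holds for almost every $t\in[0,+\infty)$, and $x(0)=x_0$. Such a solution exists and is unique. *)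

(* Defs.v *)
From HB Require Import structures.
From mathcomp Require Export all_boot all_order all_algebra.
From mathcomp Require Export all_classical all_reals all_analysis.
Export Order.TTheory GRing.Theory Num.Theory.
Export numFieldNormedType.Exports.

Set Implicit Arguments.
Unset Strict Implicit.
Unset Printing Implicit Defensive.

Local Open Scope classical_set_scope.
Local Open Scope ring_scope.

(* A set-valued operator on H is a map M : H -> set H, and u belongs to M x
   iff (x, u) lies in its graph. A real Hilbert space is a complete normed
   module H together with an inner product ip : {dot H for idfun} (a positive
   definite symmetric bilinear form) such that ip u u = `|u| ^+ 2. *)
Section Operators.
Context {R : realType} {H : completeNormedModType R}.
Implicit Types (A M N : H -> set H) (B : H -> H).

Definition op_single B : H -> set H := fun x => [set B x].

Definition op_add M N : H -> set H :=
  fun x => [set u + v | u in M x & v in N x].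

Definition op_scale (c : R) M : H -> set H := fun x => [set c *: u | u in M x].

Definition op_inv M : H -> set H := fun y => [set x | M x y].

Definition resolvent M : H -> set H := op_inv (op_add (op_single idfun) M).

Definition Zer M : set H := [set x | M x 0].

Definition monotone_op (ip : {dot H for idfun}) M : Prop :=
  forall x y u v, M x u -> M y v -> 0 <= ip (x - y) (u - v).

Definition maximally_monotone (ip : {dot H for idfun}) M : Prop :=
  monotone_op ip M /\
  forall N, monotone_op ip N -> (forall x, M x `<=` N x) ->
    forall x, N x `<=` M x.

Definition strongly_monotone (ip : {dot H for idfun}) (rho : R) M : Prop :=
  forall x y u v, M x u -> M y v ->
    rho * `|x - y| ^+ 2 <= ip (x - y) (u - v).

End Operators.

Section Bochner.
Context {d : measure_display} {T : measurableType d} {R : realType}.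
Context {H : completeNormedModType R}.
Variable mu : {measure set T -> \bar R}.

Definition integrable_step (D : set T) (s : T -> H) : Prop :=
  [/\ finite_set (range s),
      forall v, measurable (s @^-1` [set v]) &
      forall v, v != 0 -> (mu (D `&` s @^-1` [set v]) < +oo)%E].

(* The level set of v = 0 may have infinite measure; its term vanishes. *)
Definition step_integral (D : set T) (s : T -> H) : H :=
  \sum_(v \in range s) (fine (mu (D `&` s @^-1` [set v])) *: v).

(* f is Bochner integrable on D, with integral I. *)
Definition is_bochner_integral (D : set T) (f : T -> H) (I : H) : Prop :=
  exists s : nat -> T -> H,
    [/\ forall n, integrable_step D (s n),
        \forall t \ae mu, D t -> s n t @[n --> \oo] --> f t,
        (\int[mu]_(t in D) `|f t - s n t|%:E @[n --> \oo] --> 0)%E &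
        step_integral D (s n) @[n --> \oo] --> I].

End Bochner.

(* The real line with the sigma-algebra of Lebesgue (not only Borel) measurable
   sets, on which the completed Lebesgue measure lives. *)
Notation lebesgueType R :=
  (@caratheodory_type R (ocitv_type R) (wlength idfun)^*%mu).

Section Trajectories.
Context {R : realType} {H : completeNormedModType R}.

Definition lebesgue_measurable_on (D : set R) (g : R -> R) : Prop :=
  measurable_fun (D : set (lebesgueType R))
    (g : lebesgueType R -> measurableTypeR R).

(* x is locally absolutely continuous on [0, +oo[ with derivative dx. The
   values of x and dx at negative times are irrelevant. *)
Definition loc_abs_continuous (x dx : R -> H) : Prop :=
  forall b : R, 0 <= b ->
    is_bochner_integral (@completed_lebesgue_measure R) `[0, b] dx (x b - x 0).

(* The resolvent is set-valued as defined, so z t = J (...) is rendered by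
   saying that its value is the singleton {z t}. *)
Definition is_trajectory (A : H -> set H) (B : H -> H) (gamma : R -> R)
    (x0 : H) (x z : R -> H) : Prop :=
  [/\ forall t, 0 <= t ->
        resolvent (op_scale (gamma t) A) (x t - gamma t *: B (x t)) =
        [set z t],
      exists2 dx : R -> H, loc_abs_continuous x dx &
        \forall t \ae (@completed_lebesgue_measure R), 0 <= t ->
          0 = dx t + x t - z t - gamma t *: B (x t) + gamma t *: B (z t) &
      x 0 = x0].

End Trajectories.

(* Main.v *)
From mathcomp Require Import finmap measurable_realfun ring lra.
Require Import Defs.

(** The operator [A + B] has a zero because [A + B] inherits from [A] the
    surjectivity of [Id + l (A + B)] for small [l] (Minty's theorem, followed by
    a contraction argument), and the inverse of [Id + l (A + B)] is a strict
    contraction by strong monotonicity, whose fixed point is a zero [xbar].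

    Put [u = a + B z] where [a] is the element of [A z] selected by the
    resolvent; the system reads [dx = - gamma u], whence
      [- <x - xbar, dx> = gamma <u, z - xbar> + gamma <u, x - z>
         >= delta rho |z - xbar|^2 + (1 - gamma / beta) |x - z|^2
         >= c |x - xbar|^2].
    This differential inequality is integrated without a chain rule for Bochner
    primitives: over a step of length [h] on which [x] varies by at most [e],
    [|x - xbar|^2] is multiplied by at most [1 - 2 c h], up to an error bounded
    by [e] times a quantity that is additive over the steps, and [e] is
    arbitrary. *)

Set Implicit Arguments.
Unset Strict Implicit.
Unset Printing Implicit Defensive.

Local Open Scope classical_set_scope.
Local Open Scope ring_scope.

(** * Real inner products *)

Section InnerProduct.
Context {R : realType} {H : completeNormedModType R}.
Variable ip : {dot H for idfun}.
Hypothesis ip_norm : forall u : H, ip u u = `|u| ^+ 2.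

Lemma ipC u v : ip u v = ip v u.
Proof. by rewrite hermitian_subproof expr0 mul1r. Qed.

Lemma ipDl u v w : ip (u + v) w = ip u w + ip v w.
Proof. exact: linearDl. Qed.

Lemma ipDr u v w : ip u (v + w) = ip u v + ip u w.
Proof. exact: linearDr. Qed.

Lemma ipNl u v : ip (- u) v = - ip u v.
Proof. exact: linearNl. Qed.

Lemma ipNr u v : ip u (- v) = - ip u v.
Proof. exact: linearNr. Qed.

Lemma ipZl (c : R) u v : ip (c *: u) v = c * ip u v.
Proof. exact: linearZl_LR. Qed.

Lemma ipZr (c : R) u v : ip u (c *: v) = c * ip u v.
Proof. exact: linearZr_LR. Qed.

Lemma ip0r u : ip u 0 = 0.
Proof. by rewrite -(scale0r u) ipZr mul0r. Qed.

Definition ipE := (ipDl, ipDr, ipNl, ipNr, ipZl, ipZr).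

Lemma normB_sqr u v : `|u - v| ^+ 2 = `|u| ^+ 2 + `|v| ^+ 2 - 2 * ip u v.
Proof. rewrite -!ip_norm !ipE (ipC v u); ring. Qed.

Lemma normD_sqr u v : `|u + v| ^+ 2 = `|u| ^+ 2 + `|v| ^+ 2 + 2 * ip u v.
Proof. rewrite -!ip_norm !ipE (ipC v u); ring. Qed.

(** Expanding [| |v| u - |u| v |^2 >= 0] gives [2 |u| |v| (|u| |v| - <u, v>) >= 0]. *)
Lemma cauchy_schwarz u v : ip u v <= `|u| * `|v|.
Proof.
have [->|u0] := eqVneq u 0; first by rewrite ipC ip0r normr0 mul0r.
have [->|v0] := eqVneq v 0; first by rewrite ip0r normr0 mulr0.
have nu : 0 < `|u| by rewrite normr_gt0.
have nv : 0 < `|v| by rewrite normr_gt0.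
have := sqr_ge0 (`| `|v| *: u - `|u| *: v|).
rewrite normB_sqr !ipE !normrZ !normr_id => h.
have : 0 <= (2 * `|u| * `|v|) * (`|u| * `|v| - ip u v) by lra.
by rewrite pmulr_rge0 ?subr_ge0// !mulr_gt0.
Qed.

Lemma normr_ip u v : `|ip u v| <= `|u| * `|v|.
Proof.
rewrite ler_norml; apply/andP; split; last exact: cauchy_schwarz.
by rewrite lerNl -ipNl -(normrN u); exact: cauchy_schwarz.
Qed.

End InnerProduct.

(** * Minty's theorem and the zero of the sum *)

Section Minty.
Context {R : realType} {H : completeNormedModType R}.
Variable ip : {dot H for idfun}.
Hypothesis ip_norm : forall u : H, ip u u = `|u| ^+ 2.
Implicit Types (A M : H -> set H).

(** Adjoining [(x, u)] to the graph keeps it monotone, so maximality puts the pair in it already. *)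
Lemma maximal_mem A : maximally_monotone ip A -> forall x u,
  (forall a b, A a b -> 0 <= ip (x - a) (u - b)) -> A x u.
Proof.
move=> [mA maxA] x u xu.
pose N := fun y => A y `|` [set v | y = x /\ v = u].
have := maxA N; apply; last by right.
- move=> y1 y2 v1 v2 [A1|[-> ->]] [A2|[-> ->]].
  + exact: mA.
  + by rewrite -opprB -(opprB u) ipNl ipNr opprK; exact: xu.
  + exact: xu.
  + by rewrite !subrr ip0r.
- by move=> y v; left.
Qed.

(** Over an empty graph [(0, 0)] would be vacuously monotonically related, hence a member. *)
Lemma maximal_nonempty A : maximally_monotone ip A -> exists a b, A a b.
Proof.
move=> mA; apply: contrapT => nA; apply: (nA); exists 0, 0.
apply: (maximal_mem mA) => a b Aab; exfalso; apply: nA; by exists a, b.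
Qed.

Lemma cvg_sqr_dist (u : nat -> H) :
  (forall i j, `|u i - u j| ^+ 2 <= 2 * (i.+1%:R^-1 + j.+1%:R^-1)) -> cvgn u.
Proof.
move=> hu; apply/cauchy_cvgP; apply/cauchy_exP => e e0.
(* Once both reciprocals are below [e^2 / 8], the assumed bound is at most [e^2 / 2]. *)
pose d := e ^+ 2 / 8.
have d0 : 0 < d by rewrite divr_gt0// exprn_gt0.
have [N _ hN] := near_infty_natSinv_lt (PosNum d0).
exists (u N), N => // n /= Nn.
rewrite -ball_normE /= -ltr_sqr ?nnegrE ?normr_ge0 ?(ltW e0)//.
have h1 := hN _ (leqnn N); have h2 := hN _ Nn; have h3 := hu N n.
move: h1 h2 h3; rewrite /d /=.
move: (N.+1%:R^-1) (n.+1%:R^-1) => r1 r2 h1 h2 h3.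
have : 0 < e ^+ 2 by rewrite exprn_gt0.
lra.
Qed.

(* With [F] the Fitzpatrick function of [A], this says that
   [2 F x u + |x| ^ 2 + |u| ^ 2 <= s] at [x = - q], [u = - p]. *)
Definition above A (p q : H) (s : R) := forall a b, A a b ->
  `|q - b| ^+ 2 + `|p - a| ^+ 2 - `|a + b| ^+ 2 <= s.

(** For fixed [(a, b)] the expression in [above] is a sum of squared distances plus a constant, and
    each square satisfies the exact identity [E]. The subtracted term is the gain from strong
    convexity. *)
Lemma above_conv A p q s p' q' s' (t : R) : 0 <= t <= 1 ->
  above A p q s -> above A p' q' s' ->
  above A (p + t *: (p' - p)) (q + t *: (q' - q))
    (s + t * (s' - s) - t * (1 - t) * (`|p - p'| ^+ 2 + `|q - q'| ^+ 2)).
Proof.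
move=> /andP[t0 t1] h h' a b Aab; have := h _ _ Aab; have := h' _ _ Aab.
have E (x y c : H) : `|x + t *: (y - x) - c| ^+ 2 =
    (1 - t) * `|x - c| ^+ 2 + t * `|y - c| ^+ 2
    - t * (1 - t) * `|x - y| ^+ 2.
  rewrite -!ip_norm !ipE (ipC ip y x) (ipC ip c x) (ipC ip c y); ring.
rewrite !E => k' k.
have k1 := ler_wpM2l t0 k'.
have t1' : 0 <= 1 - t by lra.
have k2 := ler_wpM2l t1' k.
lra.
Qed.

(** This is [F x u >= <x, u>]. If it failed, [(- q, - p)] would be strictly monotonically related to
    every point of the graph, hence in the graph, hence strictly related to itself. *)
Lemma above_ge A p q s : maximally_monotone ip A -> above A p q s ->
  `|p + q| ^+ 2 <= s.
Proof.
move=> mA h; rewrite leNgt; apply/negP => sl.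
have k a b : A a b -> 0 < ip (- q - a) (- p - b).
  move=> /h {}h; have : `|q - b| ^+ 2 + `|p - a| ^+ 2 - `|a + b| ^+ 2
     < `|p + q| ^+ 2 by lra.
  rewrite !(normB_sqr ip_norm) !(normD_sqr ip_norm) !ipE (ipC ip q p).
  rewrite (ipC ip p a); lra.
have /k : A (- q) (- p) by apply: (maximal_mem mA) => a b /k /ltW.
by rewrite subrr ipC ip0r ltxx.
Qed.

(** Monotonicity says that [F y v <= <y, v>] at a point of the graph. *)
Lemma above_graph A y v : monotone_op ip A -> A y v ->
  above A (- v) (- y) (`|y + v| ^+ 2).
Proof.
move=> mA Ayv a b Aab; have := mA _ _ _ _ Ayv Aab.
rewrite !(normB_sqr ip_norm) !(normD_sqr ip_norm) !ipE !normrN (ipC ip v a).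
lra.
Qed.

(* The functional is strongly convex, hence minimizing sequences are Cauchy and
   no weak compactness is needed. *)
Lemma above_min A : maximally_monotone ip A -> exists p q s, above A p q s /\
  forall p' q' s', above A p' q' s' ->
    s + `|p - p'| ^+ 2 + `|q - q'| ^+ 2 <= s'.
Proof.
move=> mA; pose S := [set s | exists p q, above A p q s].
have S0 : S !=set0.
  have [a [b Aab]] := maximal_nonempty mA.
  by exists (`|a + b| ^+ 2), (- b), (- a); exact: (above_graph mA.1).
have lbS : has_lbound S.
  exists 0 => s [p [q h]]; exact: le_trans (sqr_ge0 _) (above_ge mA h).
have infS : has_inf S by split.
pose m := inf S.
have mle s p q : above A p q s -> m <= s.
  by move=> h; apply: ge_inf => //; exists p, q.
have /choice[u hu] n : exists u : H * H,
    above A u.1 u.2 (m + n.+1%:R^-1).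
  have n0 : (0 : R) < n.+1%:R^-1 by rewrite invr_gt0.
  have [s [p [q h]] sm] := inf_adherent n0 infS.
  exists (p, q) => a b Aab; apply: le_trans (h _ _ Aab) _; exact: ltW.
have hd i j : `|(u i).1 - (u j).1| ^+ 2 + `|(u i).2 - (u j).2| ^+ 2
     <= 2 * (i.+1%:R^-1 + j.+1%:R^-1).
  (* Comparing [m] with the value at the midpoint gives [m <= m + (r1 + r2) / 2 - D / 4], where [D]
     is the left-hand side of [hd]. *)
  have t01 : 0 <= (2^-1 : R) <= 1 by lra.
  have /mle := above_conv t01 (hu i) (hu j).
  move: (i.+1%:R^-1) (j.+1%:R^-1) => r1 r2.
  lra.
have c1 : cvgn (fun n => (u n).1).
  apply: cvg_sqr_dist => i j; apply: le_trans (hd i j).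
  by rewrite lerDl sqr_ge0.
have c2 : cvgn (fun n => (u n).2).
  apply: cvg_sqr_dist => i j; apply: le_trans (hd i j).
  by rewrite lerDr sqr_ge0.
set p := limn (fun n => (u n).1) in c1.
set q := limn (fun n => (u n).2) in c2.
have hm : above A p q m.
  move=> a b Aab.
  have l1 : (fun n => `|(u n).2 - b| ^+ 2 + `|(u n).1 - a| ^+ 2
      - `|a + b| ^+ 2) @ \oo --> `|q - b| ^+ 2 + `|p - a| ^+ 2 - `|a + b| ^+ 2.
    apply: cvgB; last exact: cvg_cst.
    apply: cvgD; rewrite expr2; under eq_fun do rewrite expr2;
      apply: cvgM; apply: cvg_norm; apply: cvgB => //; exact: cvg_cst.
  have l2 : (fun n => m + n.+1%:R^-1) @ \oo --> m + 0.
    by apply: cvgD; [exact: cvg_cst|exact: cvg_harmonic].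
  rewrite addr0 in l2; apply: ler_cvg_to l1 l2 _.
  by apply: nearW => n; exact: hu.
exists p, q, m; split => // p' q' s' h'.
set D := `|p - p'| ^+ 2 + `|q - q'| ^+ 2; rewrite -addrA -/D.
(* Minimality along the segment towards [(p', q')], divided by [t]; the claim is the limit
   [t -> 0]. *)
have key (t : R) : 0 < t <= 1 -> (1 - t) * D <= s' - m.
  move=> /andP[t0 t1]; have t01 : 0 <= t <= 1 by rewrite t1 ltW.
  have /mle := above_conv t01 hm h'.
  rewrite -/D => k; rewrite -(ler_pM2l t0); lra.
have D0 : 0 <= D by rewrite addr_ge0// sqr_ge0.
rewrite addrC -lerBrDr; apply/ler_addgt0Pr => e e0.
(* This [t] satisfies [t * D <= e] and makes sense also when [D = 0]. *)
have /key : 0 < e / (D + e) <= 1.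
  by rewrite divr_gt0//= ?ler_pdivrMr ?mul1r; lra.
have -> : (1 - e / (D + e)) * D = D - e * (D / (D + e)) by field; lra.
have : e * (D / (D + e)) <= e * 1.
  by rewrite ler_pM2l// ler_pdivrMr; lra.
lra.
Qed.

(* Testing the minimizer [(p, q)] against the points of the graph shows that it
   is monotonically related to [A], hence in its graph, and then [p + q = 0]. *)
Lemma minty0 A : maximally_monotone ip A -> exists x, A x (- x).
Proof.
move=> mA; have [p [q [s [h hmin]]]] := above_min mA.
have s0 := above_ge mA h.
have k a b : A a b -> `|p + q| ^+ 2 <= ip (p - a) (q - b).
  move=> Aab; have := hmin _ _ _ (above_graph mA.1 Aab).
  move: s0; rewrite !opprK !(normD_sqr ip_norm) !ipE (ipC ip q a); lra.
have Apq : A p q by apply: (maximal_mem mA) => a b /k; apply: le_trans (sqr_ge0 _).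
have := k _ _ Apq; rewrite subrr ipC ip0r exprn_even_le0//= normr_eq0 addrC addr_eq0.
by move=> /eqP qp; exists p; rewrite -qp.
Qed.

(** [A'] is [A] with its argument translated by [y] and its values scaled by [l]. It is again
    maximally monotone, and [- x] in [A' x] says that [x + y] solves the inclusion. *)
Lemma minty A (l : R) y : 0 < l -> maximally_monotone ip A ->
  exists x u, A x u /\ x + l *: u = y.
Proof.
move=> l0 mA; pose A' : H -> set H := fun x => [set u | A (x + y) (l^-1 *: u)].
have mA' : maximally_monotone ip A'.
  have l0' : 0 < l^-1 by rewrite invr_gt0.
  split.
    move=> x1 x2 u1 u2 A1 A2; have := mA.1 _ _ _ _ A1 A2.
    by rewrite -scalerBr ipZr opprD addrACA subrr addr0 pmulr_rge0.
  move=> N mN sN x u Nu; apply: (maximal_mem mA) => a b Aab.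
  have : N (a - y) (l *: b).
    by apply: sN; rewrite /A'/= subrK scalerA mulVf ?scale1r ?gt_eqF.
  move=> /(mN _ _ _ _ Nu); rewrite opprB addrA.
  have -> : u - l *: b = l *: (l^-1 *: u - b).
    by rewrite scalerBr scalerA divff ?scale1r ?gt_eqF.
  by rewrite ipZr pmulr_rge0.
have [x Ax] := minty0 mA'; exists (x + y), (l^-1 *: - x); split => //.
by rewrite scalerA divff ?gt_eqF// scale1r addrAC subrr add0r.
Qed.

Lemma lipschitz_fixpoint (f : H -> H) (q : R) : 0 <= q -> q < 1 ->
  (forall x y, `|f x - f y| <= q * `|x - y|) -> exists x, x = f x.
Proof.
move=> q0 q1 hf.
have fT : set_fun setT setT f by [].
pose g : {fun [set: H] >-> [set: H]} := mkfun fT.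
have cg : is_contraction g.
  by exists (NngNum q0); split => //= -[x y] _; exact: hf.
have [x _ hx] := banach_fixed_point cg (@closedT _) (ex_intro _ 0 I).
by exists x.
Qed.

End Minty.

(** * Existence and uniqueness of the zero, and the pointwise decay estimate *)

Section ZeroOfSum.
Context {R : realType} {H : completeNormedModType R}.
Variable ip : {dot H for idfun}.
Hypothesis ip_norm : forall u : H, ip u u = `|u| ^+ 2.
Implicit Types (A M : H -> set H) (B : H -> H).

(** Strong monotonicity bounds the inner product of [x - x'] with the right-hand difference below by
    [(1 + l rho) |x - x'|^2]; Cauchy-Schwarz then allows division by [|x - x'|]. The case [rho = 0]
    is nonexpansiveness of the resolvent. *)
Lemma resolvent_lipschitz M (rho l : R) x x' u u' : 0 <= l ->
  strongly_monotone ip rho M -> M x u -> M x' u' ->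
  (1 + l * rho) * `|x - x'| <= `|(x + l *: u) - (x' + l *: u')|.
Proof.
move=> l0 hM Mx Mx'; have [->|xx'] := eqVneq x x'.
  by rewrite subrr normr0 mulr0.
have nx : 0 < `|x - x'| by rewrite normr_gt0 subr_eq0.
rewrite -(ler_pM2l nx).
have := cauchy_schwarz ip_norm (x - x') ((x + l *: u) - (x' + l *: u')).
apply: le_trans.
have -> : x + l *: u - (x' + l *: u') = (x - x') + l *: (u - u').
  by rewrite opprD addrACA scalerBr.
rewrite ipDr ipZr ip_norm.
have := ler_wpM2l l0 (hM _ _ _ _ Mx Mx'); rewrite expr2; lra.
Qed.

Lemma zero_of_sum A B (beta rho : R) : maximally_monotone ip A ->
  0 < beta -> beta^-1.-lipschitz B -> 0 < rho ->
  strongly_monotone ip rho (op_add A (op_single B)) ->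
  exists x, Zer (op_add A (op_single B)) x.
Proof.
move=> mA beta0 lipB rho0 sAB.
have A0 : strongly_monotone ip 0 A.
  by move=> x y u v Ax Ay; rewrite mul0r; exact: mA.1 Ax Ay.
(* With this [l] the map [l B] is [1/2]-Lipschitz, so [x |-> J (y - l B x)] is a contraction for
   every [y]. *)
pose l := beta / 2; have l0 : 0 < l by rewrite divr_gt0.
have /choice[J hJ] y : exists xu : H * H, A xu.1 xu.2 /\ xu.1 + l *: xu.2 = y.
  by have [x [u h]] := minty ip_norm y l0 mA; exists (x, u).
have JB y : exists x, x = (J (y - l *: B x)).1.
  apply: (@lipschitz_fixpoint _ _ _ 2^-1) => [||x x']; [lra|lra|].
  have := resolvent_lipschitz (ltW l0) A0 (hJ (y - l *: B x)).1
    (hJ (y - l *: B x')).1.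
  rewrite !(hJ _).2 mulr0 addr0 mul1r => /le_trans; apply.
  rewrite opprD opprK addrACA subrr add0r addrC -scalerBr.
  rewrite normrZ gtr0_norm// distrC.
  have := lipB (x, x') (conj I I) => /= h.
  apply: le_trans (ler_wpM2l (ltW l0) h) _.
  by rewrite mulrA (_ : l / beta = 2^-1)// /l; field; lra.
have /choice[K hK] y : exists xu : H * H,
    op_add A (op_single B) xu.1 xu.2 /\ xu.1 + l *: xu.2 = y.
  have [x hx] := JB y; have [] := hJ (y - l *: B x); rewrite -hx => Ax e.
  exists (x, (J (y - l *: B x)).2 + B x); split => /=.
    by exists (J (y - l *: B x)).2 => //; exists (B x).
  by rewrite scalerDr addrA e subrK.
have c0 : 0 < 1 + l * rho by rewrite addr_gt0// mulr_gt0.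
(* At a fixed point [x + l u = x] with [u] in [(A + B) x], which forces [u = 0]. *)
have [x hx] : exists x, x = (K x).1.
  apply: (@lipschitz_fixpoint _ _ _ (1 + l * rho)^-1) => [||x x'].
  - by rewrite invr_ge0 ltW.
  - by rewrite invf_lt1// ltrDl mulr_gt0.
  - have := resolvent_lipschitz (ltW l0) sAB (hK x).1 (hK x').1.
    by rewrite !(hK _).2 ler_pdivlMl.
exists x; have [] := hK x; rewrite -hx => Mx /eqP.
rewrite -subr_eq0 addrAC subrr add0r scaler_eq0 gt_eqF//= => /eqP u0.
by rewrite /Zer/= -u0.
Qed.

Lemma zero_unique M (rho : R) x y : 0 < rho -> strongly_monotone ip rho M ->
  Zer M x -> Zer M y -> x = y.
Proof.
move=> rho0 sM Mx My; have := sM _ _ _ _ Mx My.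
rewrite subrr ip0r pmulr_rle0// exprn_even_le0//= normr_eq0 subr_eq0.
by move/eqP.
Qed.

(** Since [1 - gamma / beta >= epsilon / beta], the minimum is below the weights of both
    [|z - xbar|^2] and [|x - z|^2]. The factor [1/2] comes from [|x - xbar|^2 <= 2 (|z - xbar|^2 +
    |x - z|^2)]. *)
Lemma tseng_decay A B (beta rho delta epsilon gamma : R) x z dx xbar :
  0 < beta -> beta^-1.-lipschitz B -> 0 < rho ->
  strongly_monotone ip rho (op_add A (op_single B)) ->
  0 < delta -> 0 < epsilon -> delta <= gamma <= beta - epsilon ->
  Zer (op_add A (op_single B)) xbar ->
  resolvent (op_scale gamma A) (x - gamma *: B x) z ->
  0 = dx + x - z - gamma *: B x + gamma *: B z ->
  ip (x - xbar) dx <=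
    - (Num.min (delta * rho) (epsilon / beta) / 2) * `|x - xbar| ^+ 2.
Proof.
move=> beta0 lipB rho0 sAB delta0 epsilon0 /andP[dg gb] Mxbar.
move=> [_ ->] [_ [a Aa <-]] za edx.
have gamma0 : 0 < gamma by exact: lt_le_trans dg.
have Mz : op_add A (op_single B) z (a + B z) by exists a => //; exists (B z).
have := sAB _ _ _ _ Mz Mxbar; rewrite subr0 => h1.
have ea : gamma *: a = x - gamma *: B x - z by rewrite -za addrAC subrr add0r.
set u := a + B z in Mz h1.
(* This identity turns the differential equation into [dx = - gamma u], and shows that replacing
   [B x] by [B z] costs only a Lipschitz term. *)
have eu : gamma *: u = (x - z) - gamma *: (B x - B z).
  by rewrite scalerDr ea scalerBr opprD opprK addrA; congr (_ + _); rewrite addrAC.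
have {}edx : dx = - (gamma *: u).
  by apply/eqP; rewrite -addr_eq0 eu scalerBr opprD opprK !addrA -edx.
have h2 := lipB (x, z) (conj I I); rewrite /= in h2.
have h3 : gamma * ip (x - z) (B x - B z) <= gamma / beta * `|x - z| ^+ 2.
  rewrite -mulrA ler_pM2l//.
  apply: le_trans (cauchy_schwarz ip_norm _ _) _.
  by rewrite expr2 mulrCA ler_wpM2l.
have h4 : gamma * ip (x - z) u = `|x - z| ^+ 2 - gamma * ip (x - z) (B x - B z).
  by rewrite -ipZr eu ipDr ip_norm ipNr ipZr.
set c := Num.min _ _.
have c1 : c <= delta * rho by rewrite ge_min lexx.
have c2 : c <= epsilon / beta by rewrite ge_min lexx orbT.
have e1 : x - xbar = (z - xbar) + (x - z) by rewrite [RHS]addrC addrA subrK.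
have n1 : 0 <= `|z - xbar| ^+ 2 by exact: sqr_ge0.
have n2 : 0 <= `|x - z| ^+ 2 by exact: sqr_ge0.
have h5 : `|x - xbar| ^+ 2 <= 2 * (`|z - xbar| ^+ 2 + `|x - z| ^+ 2).
  have := sqr_ge0 (`|(z - xbar) - (x - z)|).
  by rewrite e1 (normB_sqr ip_norm (z - xbar)) (normD_sqr ip_norm (z - xbar)); lra.
have c0 : 0 <= c.
  by rewrite le_min !mulr_ge0 ?invr_ge0// ltW.
have h6 : delta * rho * `|z - xbar| ^+ 2 <= gamma * ip (z - xbar) u.
  apply: le_trans (ler_wpM2l (ltW gamma0) h1).
  by rewrite [leRHS]mulrA; apply: ler_wpM2r => //; apply: ler_wpM2r => //; exact: ltW.
have h7 : epsilon / beta * `|x - z| ^+ 2 <= gamma * ip (x - z) u.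
  rewrite h4.
  have : (epsilon / beta + gamma / beta) * `|x - z| ^+ 2 <= 1 * `|x - z| ^+ 2.
    by apply: ler_wpM2r => //; rewrite -mulrDl ler_pdivrMr//; lra.
  lra.
have -> : ip (x - xbar) dx = - (gamma * ip (z - xbar) u + gamma * ip (x - z) u).
  by rewrite edx ipNr ipZr e1 ipDl mulrDr.
have k1 := ler_wpM2r n1 c1.
have k2 := ler_wpM2r n2 c2.
have k3 := ler_wpM2l c0 h5.
lra.
Qed.

End ZeroOfSum.

(** * Bochner integrals tested against vectors *)

Section AlmostEverywhere.
Context d (T : measurableType d) {R : realType} (mu : {measure set T -> \bar R}).

(** Removing the exceptional null set changes neither integral, and off it the comparison is
    pointwise. *)
Lemma ae_le_Rintegral (D : set T) (f g : T -> R) : measurable D ->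
  mu.-integrable D (EFin \o f) -> mu.-integrable D (EFin \o g) ->
  (\forall t \ae mu, D t -> f t <= g t) ->
  \int[mu]_(t in D) f t <= \int[mu]_(t in D) g t.
Proof.
move=> mD intf intg [N [mN N0 subN]].
have E (h : T -> R) : mu.-integrable D (EFin \o h) ->
    \int[mu]_(t in D) h t = \int[mu]_(t in D `\` N) h t.
  by move=> inth; rewrite /Rintegral (negligible_integral mN).
have mDN : measurable (D `\` N) by exact: measurableD.
rewrite !E//; apply: le_Rintegral => //.
- by apply: integrableS intf => //; exact: subDsetl.
- by apply: integrableS intg => //; exact: subDsetl.
- move=> t [Dt Nt]; apply: contrapT => fg; apply: Nt; apply: subN.
  by move=> /= /(_ Dt).
Qed.

Hypothesis mu_complete : measure_is_complete mu.

(** Multiplying by the indicator of the complement of the null set makes the convergence hold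
    everywhere on [D]; completeness transfers measurability from [k] back to [h]. *)
Lemma measurable_fun_cvg_ae (D : set T) (g : nat -> T -> R) (h : T -> R) :
  measurable D -> (forall n, measurable_fun D (g n)) ->
  (\forall t \ae mu, D t -> g n t @[n --> \oo] --> h t) ->
  measurable_fun D h.
Proof.
move=> mD mg [N [mN N0 subN]].
have mN' : measurable_fun D (\1_(~` N) : T -> R).
  by apply: measurable_indic; exact: measurableC.
pose k := fun t => h t * \1_(~` N) t.
have mk : measurable_fun D k.
  apply: (@measurable_fun_cvg _ _ _ D (fun n t => g n t * \1_(~` N) t)).
    by move=> n; exact: measurable_funM.
  move=> t Dt; rewrite /k indicE; have [tN|tN] := boolP (t \in ~` N).
    apply: cvgM; last exact: cvg_cst.
    apply: contrapT => gh; move: tN; rewrite inE => tN; apply: tN; apply: subN.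
    by move=> /= /(_ Dt).
  rewrite mulr0; under eq_fun do rewrite mulr0; exact: cvg_cst.
apply/measurable_EFinP; apply: (ae_measurable_fun mu_complete (f := EFin \o k));
  last exact/measurable_EFinP.
exists N; split => // t /= ht; apply: contrapT => Nt; apply: ht => _.
by rewrite /k indicE mem_set// mulr1.
Qed.

End AlmostEverywhere.

(** * Step functions and their scalar integrals *)

Section StepFunctions.
Context d (T : measurableType d) {R : realType} {H : completeNormedModType R}.
Variables (mu : {measure set T -> \bar R}) (D : set T).
Hypotheses (mD : measurable D) (muD : (mu D < +oo)%E).
Variable ip : {dot H for idfun}.

(** The pair [(s, s')] takes finitely many values, so a preimage is a finite union of intersections
    of level sets, whatever [g] is. *)
Lemma measurable_fun_step2 (s s' : T -> H) (g : H -> H -> R) :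
  integrable_step mu D s -> integrable_step mu D s' ->
  measurable_fun D (fun t => g (s t) (s' t)).
Proof.
move=> [fs ms _] [fs' ms' _] _ Y mY; apply: measurableI => //.
rewrite [X in measurable X](_ : _ =
    \bigcup_(v in range s) \bigcup_(w in range s')
      if `[< Y (g v w) >] then s @^-1` [set v] `&` s' @^-1` [set w] else set0).
  apply: fin_bigcup_measurable => // v _; apply: fin_bigcup_measurable => // w _.
  case: ifPn => _; last exact: measurable0.
  by apply: measurableI; [exact: ms|exact: ms'].
apply/seteqP; split => [t /= Yt|t [v _ [w _]]].
  by exists (s t) => //; exists (s' t) => //; rewrite asboolT.
by case: ifPn => // /asboolP Yvw [/= -> ->].
Qed.

Lemma measurable_fun_step (s : T -> H) (g : H -> R) :
  integrable_step mu D s -> measurable_fun D (g \o s).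
Proof.
by move=> ss; exact: (@measurable_fun_step2 s s (fun v _ => g v)).
Qed.

Lemma integrable_comp_step (s : T -> H) (g : H -> R) :
  integrable_step mu D s -> mu.-integrable D (EFin \o (g \o s)).
Proof.
move=> ss; apply: measurable_bounded_integrable => //.
  exact: measurable_fun_step.
have [fs _ _] := ss.
(* The sum over the finite range serves as a bound for the largest [|g v|]. *)
exists (\sum_(v \in range s) `|g v|); split; first exact: num_real.
move=> M hM t Dt /=; apply: le_trans (ltW hM).
rewrite fsbig_finite// (big_fsetD1 (s t))/=; last first.
  by rewrite in_fset_set// inE; exists t.
by rewrite lerDl sumr_ge0.
Qed.

(** The function [<h, s>] is a finite combination of indicators of level sets, which is integrated
    termwise. *)
Lemma ip_step_integral (h : H) (s : T -> H) : integrable_step mu D s ->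
  ip h (step_integral mu D s) = \int[mu]_(t in D) ip h (s t).
Proof.
move=> ss; have [fs ms _] := ss.
rewrite /step_integral fsbig_finite// linear_sum /=.
have ii v : mu.-integrable D (EFin \o (\1_(s @^-1` [set v]) : T -> R)).
  apply: measurable_bounded_integrable => //.
  exists 1; split => // M M1 t Dt /=; rewrite indicE ger0_norm// ltW//.
  by apply: le_lt_trans M1; case: (_ \in _).
have iv v : mu.-integrable D (fun t => (ip h v * \1_(s @^-1` [set v]) t)%:E).
  under eq_fun do rewrite EFinM.
  by apply: integrableZl => //; exact: ii.
have E t : (ip h (s t))%:E =
   (\sum_(v <- fset_set (range s)) (ip h v * \1_(s @^-1` [set v]) t)%:E)%E.
  rewrite (big_fsetD1 (s t))/=; last by rewrite in_fset_set// inE; exists t.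
  rewrite indicE mem_set//= mulr1 big1_seq ?adde0// => v.
  rewrite !inE => /andP[_ /andP[vt _]].
  rewrite indicE memNset ?mulr0//= => e; by rewrite e eqxx in vt.
rewrite /Rintegral; under eq_integral do rewrite E.
rewrite integral_sum//.
rewrite (eq_bigr (fun v => (ip h v * fine (mu (D `&` s @^-1` [set v])))%:E)).
  rewrite sumEFin/=; apply: eq_bigr => v _; by rewrite ipZr mulrC.
move=> v _; under eq_integral do rewrite EFinM.
rewrite integralZl//; last exact: ii.
rewrite integral_indic// setIC EFinM fineK// ge0_fin_numE//.
by apply: le_lt_trans muD; apply: le_measure; rewrite ?inE//; exact: measurableI.
Qed.

End StepFunctions.

(** * From Bochner integrals to scalar Lebesgue integrals *)

Section Bochner.
Context d (T : measurableType d) {R : realType} {H : completeNormedModType R}.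
Variables (mu : {measure set T -> \bar R}) (D : set T).
Hypotheses (mD : measurable D) (muD : (mu D < +oo)%E).
Hypothesis mu_complete : measure_is_complete mu.
Variable ip : {dot H for idfun}.
Hypothesis ip_norm : forall u : H, ip u u = `|u| ^+ 2.

Lemma cvg_ip (u : nat -> H) (h l : H) :
  u n @[n --> \oo] --> l -> ip h (u n) @[n --> \oo] --> ip h l.
Proof.
move=> ul; apply/cvgrPdist_le => e e0.
have h0 : 0 < `|h| + 1 by rewrite ltr_wpDl.
have /cvgrPdist_le/(_ (e / (`|h| + 1))) := ul.
rewrite divr_gt0// => /(_ isT); apply: filterS => n.
rewrite -ipNr -ipDr ler_pdivlMr// => hn; apply: le_trans (normr_ip ip_norm _ _) _.
apply: le_trans hn; rewrite mulrC ler_wpM2l// lerDl//.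
Qed.

(** Bochner integrals enter the sequel only through these scalar integrals. Measurability passes to
    the almost everywhere limit of the steps, integrability comes from
    [|f| <= |f - s n| + |s n|]. *)
Lemma bochner_integralP (f : T -> H) (I : H) :
  is_bochner_integral mu D f I ->
  [/\ mu.-integrable D (EFin \o (fun t => `|f t|)),
      forall h, mu.-integrable D (EFin \o (fun t => ip h (f t))) &
      forall h, ip h I = \int[mu]_(t in D) ip h (f t)].
Proof.
move=> [s [ss sf sint sI]].
have mip h : measurable_fun D (fun t => ip h (f t)).
  apply: (measurable_fun_cvg_ae mu_complete (g := fun n t => ip h (s n t))) => //.
    by move=> n; exact: (measurable_fun_step mD (ip h) (ss n)).
  by apply: filterS sf => t /[apply] /cvg_ip.
have mB n : measurable_fun D (fun t => `|f t - s n t|).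
  apply: (measurable_fun_cvg_ae mu_complete
    (g := fun m t => `|s m t - s n t|)) => //.
    move=> m; exact: (measurable_fun_step2 mD (fun v w => `|v - w|) (ss m) (ss n)).
  apply: filterS sf => t /[apply] h; apply: cvg_norm.
  by apply: cvgB => //; exact: cvg_cst.
have mf : measurable_fun D (fun t => `|f t|).
  apply: (measurable_fun_cvg_ae mu_complete (g := fun m t => `|s m t|)) => //.
    by move=> m; exact: (measurable_fun_step mD _ (ss m)).
  by apply: filterS sf => t /[apply] h; exact: cvg_norm.
have [fin cvg0] := (fine_cvgP _ _).1 sint.
(* Integrals that tend to [0] are finite from some index on. *)
have iB : \forall n \near \oo, mu.-integrable D (fun t => `|f t - s n t|%:E).
  apply: filterS fin => n hn; apply/integrableP; split.
    exact/measurable_EFinP.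
  by rewrite (eq_integral (fun t => `|f t - s n t|%:E)) ?ltey_eq ?hn// => t _;
    rewrite /= normr_id.
have is_ n : mu.-integrable D (EFin \o (fun t => `|s n t|)).
  exact: (integrable_comp_step mD muD _ (ss n)).
have if_ : mu.-integrable D (EFin \o (fun t => `|f t|)).
  have [n _ /(_ n (leqnn n)) hn] := iB.
  apply: le_integrable (integrableD mD hn (is_ n)) => //.
    exact/measurable_EFinP.
  move=> t Dt /=; rewrite lee_fin normr_id ger0_norm ?addr_ge0//.
  by rewrite -{1}(subrK (s n t) (f t)); exact: ler_normD.
have ih h : mu.-integrable D (EFin \o (fun t => ip h (f t))).
  apply: le_integrable (integrableZl mD `|h| if_) => //.
    exact/measurable_EFinP.
  by move=> t Dt /=; rewrite lee_fin normrM !normr_id; exact: (normr_ip ip_norm).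
split => // h.
have c1 := cvg_ip (h := h) sI.
(* The error is at most [|h|] times the integral of [|f - s n|]; using [|h| + 1] avoids dividing by
   zero. *)
suff c2 : ip h (step_integral mu D (s n)) @[n --> \oo] -->
    \int[mu]_(t in D) ip h (f t) by exact: cvg_unique c1 c2.
apply/cvgrPdist_le => e e0.
have h0 : 0 < `|h| + 1 by rewrite ltr_wpDl.
have /cvgrPdist_le/(_ (e / (`|h| + 1))) := cvg0.
rewrite divr_gt0// => /(_ isT); apply: filterS2 iB => n iBn.
rewrite sub0r normrN ler_pdivlMr// => hn.
rewrite (ip_step_integral mD muD ip h (ss n)) -RintegralB//; last first.
  exact: (integrable_comp_step mD muD (ip h) (ss n)).
have iBn' : mu.-integrable D (EFin \o (fun t => `|h| * `|f t - s n t|)).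
  exact: (integrableZl mD `|h| iBn).
have mB' : mu.-integrable D (EFin \o (fun t => ip h (f t) - ip h (s n t))).
  exact: (integrableB mD (ih h) (integrable_comp_step mD muD (ip h) (ss n))).
apply: le_trans (le_normr_Rintegral mD mB') _.
apply: le_trans (le_Rintegral mD _ iBn' _) _.
- exact: integrable_norm.
- by move=> t Dt; rewrite -ipNr -ipDr; exact: (normr_ip ip_norm).
- rewrite RintegralZl//; apply: le_trans hn.
  rewrite mulrC; apply: ler_pM => //.
  + by apply: fine_ge0; apply: integral_ge0.
  + exact: ler_norm.
  + by rewrite lerDl.
Qed.

End Bochner.

(** * Exponential decay along absolutely continuous curves *)

Section AbsoluteContinuity.
Context {R : realType} {H : completeNormedModType R}.
Variable ip : {dot H for idfun}.
Hypothesis ip_norm : forall u : H, ip u u = `|u| ^+ 2.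
Notation mu := (@completed_lebesgue_measure R).

Lemma lebesgue_measurable_itv (i : interval R) :
  measurable ([set` i] : set (lebesgueType R)).
Proof. by apply: sub_caratheodory; exact: measurable_itv. Qed.

Lemma completed_lebesgue_measure_oc (a b : R) : a <= b ->
  mu `]a, b] = (b - a)%:E.
Proof.
move=> ab; rewrite -[LHS]/(@lebesgue_measure R `]a, b]) lebesgue_measure_itv/=.
rewrite lte_fin EFinB lt_neqAle ab andbT; case: eqP => //= ->.
by rewrite subee.
Qed.

Lemma completed_lebesgue_measure_cc_lty (a b : R) : (mu `[a, b] < +oo)%E.
Proof.
rewrite -[X in (X < _)%E]/(@lebesgue_measure R `[a, b]) lebesgue_measure_itv/=.
by case: ifP => // _; rewrite -EFinB ltry.
Qed.

Variables (x dx : R -> H).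
Hypothesis hx : loc_abs_continuous x dx.

(** Half-open intervals make adjacent pieces disjoint, hence [variation] additive. *)
Definition variation (a b : R) : R :=
  \int[mu]_(t in (`]a, b] : set (lebesgueType R))) `|dx t|.

Lemma loc_abs_continuous_integrable (b : R) : 0 <= b ->
  [/\ mu.-integrable (`[0, b] : set (lebesgueType R))
        (EFin \o (fun t => `|dx t|)),
      forall h, mu.-integrable (`[0, b] : set (lebesgueType R))
        (EFin \o (fun t => ip h (dx t))) &
      forall h, ip h (x b - x 0) =
        \int[mu]_(t in (`[0, b] : set (lebesgueType R))) ip h (dx t)].
Proof.
move=> b0; apply: bochner_integralP (hx b0) => //.
- exact: lebesgue_measurable_itv.
- exact: completed_lebesgue_measure_cc_lty.
- exact: completed_lebesgue_measure_is_complete.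
Qed.

Lemma sub_itv (a b c : R) : 0 <= a -> b <= c -> `]a, b] `<=` `[0, c].
Proof. by move=> a0 bc; apply: subset_itvScc; rewrite bnd_simp. Qed.

Lemma integrable_oc (f : lebesgueType R -> \bar R) (a b : R) : 0 <= a -> a <= b ->
  mu.-integrable (`[0, b] : set (lebesgueType R)) f ->
  mu.-integrable (`]a, b] : set (lebesgueType R)) f.
Proof.
move=> a0 ab; apply: integrableS => //.
- exact: lebesgue_measurable_itv.
- exact: lebesgue_measurable_itv.
- exact: sub_itv.
Qed.

Lemma Rintegral_split (f : lebesgueType R -> R) (i j k : interval R) :
  [set` i] = [set` j] `|` [set` k] -> [disjoint [set` j] & [set` k]] ->
  mu.-integrable ([set` i] : set (lebesgueType R)) (EFin \o f) ->
  \int[mu]_(t in ([set` i] : set (lebesgueType R))) f t =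
  \int[mu]_(t in ([set` j] : set (lebesgueType R))) f t +
  \int[mu]_(t in ([set` k] : set (lebesgueType R))) f t.
Proof.
move=> -> jk intf; apply: Rintegral_setU => //; exact: lebesgue_measurable_itv.
Qed.

Lemma variation_ge0 a b : 0 <= variation a b.
Proof. exact: Rintegral_ge0. Qed.

Lemma variationD a b c : 0 <= a -> a <= b -> b <= c ->
  variation a c = variation a b + variation b c.
Proof.
move=> a0 ab bc; apply: Rintegral_split.
- by apply: itv_bndbnd_setU; rewrite bnd_simp.
- by apply/disj_setPS => t [/=]; rewrite !in_itv/=; lra.
- apply: integrable_oc; rewrite ?(le_trans ab)//.
  by have [] := loc_abs_continuous_integrable (le_trans a0 (le_trans ab bc)).
Qed.

Lemma ip_increment h a b : 0 <= a -> a <= b ->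
  ip h (x b - x a) = \int[mu]_(t in (`]a, b] : set (lebesgueType R))) ip h (dx t).
Proof.
move=> a0 ab; have b0 := le_trans a0 ab.
have [_ _ /(_ h) ea] := loc_abs_continuous_integrable a0.
have [_ /(_ h) ih /(_ h) eb] := loc_abs_continuous_integrable b0.
have -> : x b - x a = (x b - x 0) - (x a - x 0) by rewrite opprB addrA subrK.
rewrite ipDr ipNr ea eb (@Rintegral_split _ `[0, b] `[0, a] `]a, b])//.
- by rewrite addrC addKr.
- by apply: itv_bndbnd_setU; rewrite bnd_simp.
- by apply/disj_setPS => t [/=]; rewrite !in_itv/=; lra.
Qed.

(** The increment is tested against itself, and one factor [|x b - x a|] is cancelled. *)
Lemma normB_variation a b : 0 <= a -> a <= b -> `|x b - x a| <= variation a b.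
Proof.
move=> a0 ab; have b0 := le_trans a0 ab.
have [->|/negPf xab] := eqVneq (x b - x a) 0.
  by rewrite normr0 variation_ge0.
have xab0 : 0 < `|x b - x a| by rewrite normr_gt0 xab.
rewrite -(ler_pM2l xab0) -expr2 -ip_norm ip_increment//.
have [inorm iip _] := loc_abs_continuous_integrable b0.
have inorm' := integrable_oc a0 ab inorm.
rewrite /variation -RintegralZl//; last exact: lebesgue_measurable_itv.
apply: le_Rintegral.
- exact: lebesgue_measurable_itv.
- exact: integrable_oc.
- exact: (integrableZl (lebesgue_measurable_itv _) `|x b - x a| inorm').
- by move=> t _; exact: cauchy_schwarz.
Qed.

(** Absolute continuity of the integral of [|dx|], extended by zero outside [[0, T]]; [del] does not
    depend on the position of the interval. *)
Lemma variation_small (T e : R) : 0 <= T -> 0 < e ->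
  exists2 del : R, 0 < del & forall a b, 0 <= a -> a <= b -> b <= T ->
    b - a < del -> variation a b < e.
Proof.
move=> T0 e0; have [inorm _ _] := loc_abs_continuous_integrable T0.
pose g : lebesgueType R -> R := (fun t => `|dx t|) \_ `[0, T].
have ig : mu.-integrable setT (EFin \o g).
  rewrite /g -restrict_EFin.
  by apply/(integrable_mkcond _ (lebesgue_measurable_itv _)).
have [del [del0 hdel]] := integral_normr_continuous ig e0.
exists del => // a b a0 ab bT bad.
have muab : (mu `]a, b] < del%:E)%E.
  by rewrite completed_lebesgue_measure_oc ?lte_fin.
have := hdel `]a, b]%classic (lebesgue_measurable_itv _) muab.
apply: le_lt_trans; rewrite le_eqVlt; apply/orP; left; apply/eqP.
apply: eq_Rintegral => t; rewrite inE => tab.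
rewrite /g patchE mem_set ?normr_id//; exact: sub_itv tab.
Qed.

(** * Integration of the differential inequality by time steps *)

Variables (xbar : H) (c : R).
Hypothesis decay : \forall t \ae mu, 0 <= t ->
  ip (x t - xbar) (dx t) <= - c * `|x t - xbar| ^+ 2.
Hypothesis c_gt0 : 0 < c.

Let w t := x t - xbar.

Lemma variation_le a b a' b' : 0 <= a -> a <= a' -> a' <= b' -> b' <= b ->
  variation a' b' <= variation a b.
Proof.
move=> a0 aa' ab' bb'.
rewrite (@variationD a a' b)// ?(le_trans ab')//.
rewrite (@variationD a' b' b)// ?(le_trans a0)//.
by rewrite addrCA lerDl addr_ge0// variation_ge0.
Qed.

(** For [t] in the step, [p = w a + w b] differs from [2 w t] by at most [e], and [|w t|^2] is at
    least [|w a|^2 - 2 e M]. Hence [<p, dx t> <= K + e |dx t|], which is then integrated. *)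
Lemma decay_step (a b e M : R) : 0 <= a -> a <= b -> `|w a| <= M ->
  variation a b <= e ->
  `|w b| ^+ 2 <= (1 - 2 * c * (b - a)) * `|w a| ^+ 2
    + e * (4 * c * M * (b - a) + variation a b).
Proof.
move=> a0 ab waM Ve; have b0 := le_trans a0 ab.
have e0 : 0 <= e := le_trans (variation_ge0 a b) Ve.
have M0 : 0 <= M := le_trans (normr_ge0 _) waM.
have xw s t : x s - x t = w s - w t by rewrite /w opprB addrA subrK.
pose p := w a + w b.
pose K := - 2 * c * (`|w a| ^+ 2 - 2 * e * M).
have [inorm iip _] := loc_abs_continuous_integrable b0.
have inorm' := integrable_oc a0 ab inorm.
have iip' := integrable_oc a0 ab (iip p).
have mab := lebesgue_measurable_itv `]a, b].
have muab : (mu `]a, b] < +oo)%E by rewrite completed_lebesgue_measure_oc ?ltry.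
have iK : mu.-integrable (`]a, b] : set (lebesgueType R)) (EFin \o cst K).
  by apply: measurable_bounded_integrable => //; exact: bounded_cst.
have ieV : mu.-integrable (`]a, b] : set (lebesgueType R))
   (EFin \o (fun t => e * `|dx t|)).
  exact: (integrableZl mab e inorm').
have pw : \forall t \ae mu, `]a, b]%classic t ->
    ip p (dx t) <= K + e * `|dx t|.
  have muF : Filter (almost_everywhere mu).
    exact: (ae_filter_ringOfSetsType
      (mu : {measure set (lebesgueType R) -> \bar R})).
  apply: filterS decay => t ht; rewrite /= in_itv/= => /andP[at_ tb].
  have {at_} at_ := ltW at_.
  have {}ht := ht (le_trans a0 at_).
  rewrite -/(w t) in ht.
  have wt : `|w t - w a| <= variation a t by rewrite -xw; exact: normB_variation.
  have wb : `|w b - w t| <= variation t b.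
    by rewrite -xw normB_variation// (le_trans a0).
  have Vatb : variation a b = variation a t + variation t b by exact: variationD.
  have pE : p = 2 *: w t + ((w b - w t) - (w t - w a)).
    rewrite /p; move: (w a) (w b) (w t) => u1 u2 u3.
    by rewrite scaler_nat mulr2n opprB addrACA !subrKC addrC.
  have np : `|(w b - w t) - (w t - w a)| <= e.
    by apply: le_trans (ler_normB _ _) _; lra.
  have h1 : ip p (dx t) <= 2 * ip (w t) (dx t) + e * `|dx t|.
    rewrite pE ipDl ipZl lerD2l.
    apply: le_trans (cauchy_schwarz ip_norm _ _) _.
    by apply: ler_wpM2r.
  have wa : `|w a| <= `|w t| + e.
    rewrite -[w a](subKr (w t)); apply: le_trans (ler_normB _ _) _.
    by rewrite lerD2l; apply: le_trans wt _; have := variation_ge0 t b; lra.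
  (* If [|w t| <= |w a|], then [|w a|^2 <= |w t|^2 + e (|w t| + |w a|)]; otherwise the bound is
     immediate. *)
  have h2 : `|w a| ^+ 2 - 2 * e * M <= `|w t| ^+ 2.
    have n1 := normr_ge0 (w a); have n2 := normr_ge0 (w t).
    have h3 : `|w a| * `|w a| <= (`|w t| + e) * `|w a| by apply: ler_wpM2r.
    have h4 : e * `|w a| <= e * M by apply: ler_wpM2l.
    have h5 : `|w t| * `|w a| <= `|w t| * (`|w t| + e) by apply: ler_wpM2l.
    have h6 : e * e >= 0 by apply: mulr_ge0.
    have [l|l] := leP (`|w t|) `|w a|.
      have h7 : e * `|w t| <= e * `|w a| by apply: ler_wpM2l.
      rewrite !expr2; lra.
    have h7 : `|w a| ^+ 2 <= `|w t| ^+ 2 by rewrite ler_sqr ?nnegrE// ltW.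
    have : 0 <= e * M by apply: mulr_ge0.
    lra.
  have := ler_wpM2l (ltW c_gt0) h2.
  rewrite /K; lra.
(* The increment of [|w|^2] is that of [x] tested against [w a + w b]. *)
have main : `|w b| ^+ 2 - `|w a| ^+ 2 <= K * (b - a) + e * variation a b.
  have -> : `|w b| ^+ 2 - `|w a| ^+ 2 = ip p (x b - x a).
    rewrite xw /p; move: (w a) (w b) => u1 u2.
    by rewrite ipDl !ipDr !ipNr !ip_norm (ipC ip u2 u1); ring.
  rewrite ip_increment//.
  apply: le_trans (ae_le_Rintegral mab iip' (integrableD mab iK ieV) pw) _.
  rewrite RintegralD// RintegralZl// Rintegral_cst//.
  by rewrite lerD2r (congr1 fine (completed_lebesgue_measure_oc ab)).
rewrite /K in main; lra.
Qed.

(** Iterating [decay_step] over [N] equal steps gives the factor [(1 - 2 c T / N)^N] and a total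
    error [e * L], where [L] depends on neither [e] nor [N]. *)
Lemma exp_decay_sqr (T : R) : 0 <= T ->
  `|w T| ^+ 2 <= expR (- (2 * c * T)) * `|w 0| ^+ 2.
Proof.
move=> T0; pose M := `|w 0| + variation 0 T.
pose L := 4 * c * M * T + variation 0 T.
have M0 : 0 <= M by rewrite addr_ge0// variation_ge0.
have cM0 : 0 <= 4 * c * M by rewrite !mulr_ge0// ltW.
have L0 : 0 <= L by rewrite addr_ge0 ?variation_ge0// mulr_ge0.
suff key e : 0 < e ->
    `|w T| ^+ 2 <= expR (- (2 * c * T)) * `|w 0| ^+ 2 + e * L.
  apply/ler_addgt0Pr => e e0.
  have L1 : 0 < L + 1 by rewrite ltr_wpDl.
  apply: le_trans (key (e / (L + 1)) _) _; first by rewrite divr_gt0.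
  by rewrite lerD2l -mulrA -[leRHS]mulr1 ler_pM2l// ler_pdivrMl// mulr1 lerDl.
move=> e0; have [del del0 hdel] := variation_small T0 e0.
have [N N0 hN] : exists2 N : nat, (0 < N)%N &
    T / N%:R < del /\ 2 * c * (T / N%:R) <= 1.
  (* Any [N > q] meets both demands: mesh below [del], and a nonnegative factor [r]. *)
  pose q := T / del + 2 * c * T.
  have q0 : 0 <= q by rewrite addr_ge0 ?divr_ge0 ?mulr_ge0// ltW.
  exists (Num.bound q).+1 => //.
  have qN : q < (Num.bound q).+1%:R.
    by apply: lt_le_trans (archi_boundP q0) _; rewrite ler_nat.
  have d1 : 0 <= T / del by rewrite divr_ge0// ltW.
  have d2 : 0 <= 2 * c * T by rewrite !mulr_ge0// ltW.
  split.
    by rewrite ltr_pdivrMr// mulrC -ltr_pdivrMr//; move: qN; rewrite /q; lra.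
  by rewrite mulrA ler_pdivrMr// mul1r; move: qN; rewrite /q; lra.
have NR : 0 < N%:R :> R by rewrite ltr0n.
pose h := T / N%:R; pose r := 1 - 2 * c * h.
have h0 : 0 <= h by rewrite divr_ge0.
have r0 : 0 <= r by rewrite subr_ge0 hN.2.
have hk k : (k <= N)%N -> `|w (k%:R * h)| ^+ 2 <=
    r ^+ k * `|w 0| ^+ 2 + e * (4 * c * M * (k%:R * h) + variation 0 (k%:R * h)).
  elim: k => [_|k IH kN].
    rewrite mul0r mulr0 expr0 mul1r add0r lerDl mulr_ge0// ?variation_ge0//.
    exact: ltW.
  have {}IH := IH (ltnW kN).
  have kh0 : 0 <= k%:R * h by rewrite mulr_ge0.
  have kS : k.+1%:R * h = k%:R * h + h by rewrite -natr1 mulrDl mul1r.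
  have khS : k%:R * h <= k.+1%:R * h by rewrite kS lerDl.
  have kT : k.+1%:R * h <= T.
    by rewrite /h mulrCA ler_piMr// ler_pdivrMr// mul1r ler_nat.
  have V1 : variation (k%:R * h) (k.+1%:R * h) <= e.
    by apply/ltW/hdel => //; rewrite kS addrAC subrr add0r hN.1.
  have wM : `|w (k%:R * h)| <= M.
    have -> : w (k%:R * h) = w 0 + (x (k%:R * h) - x 0).
      by rewrite /w [RHS]addrC addrA subrK.
    apply: le_trans (ler_normD _ _) _; rewrite lerD2l.
    apply: le_trans (normB_variation _ _) _ => //.
    by apply: variation_le => //; exact: le_trans kT.
  have := decay_step kh0 khS wM V1.
  rewrite (@variationD 0 (k%:R * h) (k.+1%:R * h))// kS (addrAC _ h) subrr add0r.
  rewrite -/r (exprS r).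
  have := ler_wpM2l r0 IH.
  set P := e * (_ + variation 0 (k%:R * h)) in IH *.
  have P0 : 0 <= P by rewrite mulr_ge0 ?addr_ge0 ?variation_ge0 ?mulr_ge0// ltW.
  (* As [r <= 1], earlier errors are not amplified and simply add up. *)
  have : r * P <= P by rewrite ler_piMl// /r gerBl !mulr_ge0// ltW.
  rewrite {2}/P; lra.
have := hk N (leqnn N).
have -> : N%:R * h = T by rewrite /h mulrC divfK ?gt_eqF.
move=> /le_trans; apply; rewrite lerD2r ler_wpM2r// ?sqr_ge0//.
(* The inequality [1 + y <= exp y] at [y = - 2 c h] is raised to the power [N], which [r >= 0]
   permits. *)
have -> : - (2 * c * T) = N%:R * (- (2 * c * h)).
  by rewrite /h; field; rewrite gt_eqF.
rewrite expRM_natl lerXn2r ?nnegrE ?expR_ge0//.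
exact: expR_ge1Dx.
Qed.

Lemma exp_decay (T : R) : 0 <= T -> `|w T| <= `|w 0| * expR (- (c * T)).
Proof.
move=> T0; rewrite -ler_sqr ?nnegrE ?mulr_ge0 ?expR_ge0//.
have := exp_decay_sqr T0; have -> : - (2 * c * T) = 2%:R * - (c * T) by ring.
by rewrite expRM_natl exprMn [X in _ <= X]mulrC.
Qed.

End AbsoluteContinuity.

Theorem corollary1 (R : realType) (H : completeNormedModType R)
    (ip : {dot H for idfun}) (ip_norm : forall u : H, ip u u = `|u| ^+ 2)
    (A : H -> set H) (hA : maximally_monotone ip A)
    (beta : R) (beta_gt0 : 0 < beta)
    (B : H -> H) (hB : monotone_op ip (op_single B))
    (hBlip : beta^-1.-lipschitz B)
    (rho : R) (rho_gt0 : 0 < rho)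
    (hAB : strongly_monotone ip rho (op_add A (op_single B)))
    (gamma : R -> R)
    (gamma_meas : lebesgue_measurable_on `[0, +oo[ gamma)
    (gamma_range : forall t, 0 <= t -> 0 < gamma t < beta)
    (delta epsilon : R) (delta_gt0 : 0 < delta) (epsilon_gt0 : 0 < epsilon)
    (gamma_bounds : forall t, 0 <= t -> delta <= gamma t <= beta - epsilon)
    (x0 : H) (x z : R -> H) (hxz : is_trajectory A B gamma x0 x z) :
  exists2 xbar : H, Zer (op_add A (op_single B)) = [set xbar] &
    exists2 C : R, 0 <= C & exists2 c : R, 0 < c &
      forall t, 0 <= t -> `|x t - xbar| <= C * expR (- (c * t)).
Proof.
have [res [dx hx ode] x0E] := hxz.
have [xbar Mxbar] := zero_of_sum ip_norm hA beta_gt0 hBlip rho_gt0 hAB.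
exists xbar.
  apply/seteqP; split => [y My|y ->//].
  exact: (zero_unique rho_gt0 hAB My Mxbar).
(* [C] is the initial distance to the zero and [c] the constant of [tseng_decay]. *)
exists `|x 0 - xbar| => //.
pose c := Num.min (delta * rho) (epsilon / beta) / 2.
have c_gt0 : 0 < c.
  by rewrite divr_gt0// lt_min mulr_gt0//= divr_gt0.
exists c => // t t0.
apply: (exp_decay ip_norm hx _ c_gt0 t0).
have muF : Filter (almost_everywhere (@completed_lebesgue_measure R)).
  exact: (ae_filter_ringOfSetsType
    (@completed_lebesgue_measure R : {measure set (lebesgueType R) -> \bar R})).
apply: filterS ode => s odes s0.
apply: (tseng_decay ip_norm beta_gt0 hBlip rho_gt0 hAB delta_gt0 epsilon_gt0
  (gamma_bounds _ s0) Mxbar _ (odes s0)).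
by rewrite (res _ s0).
Qed.
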